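(* Let $Z$ be a random variable distributed according to the standard Gaussian distribution. Let $q$ be a real-valued function on databases with global sensitivity $\Delta > 0$, let $\sigma > 0$, $\epsilon \ge 0$ and $\delta \ge 0$. If $$\Pr\left(Z > \frac{\sigma\epsilon}{\Delta} - \frac{\Delta}{2\sigma}\right) \le \delta,$$ then the mechanism that on input a database $d$ returns a variate of $q(d) + \sigma Z$ is $(\epsilon,\delta)$-differentially private.
   Context: A database is a (finite) collection of record values from some set $V$. Two databases $d, d'$ are neighboring if one can be obtained from the other by adding one record; $\mathcal{N}$ denotes the set of all (ordered, in either order) pairs $(d,d')$ of neighboring databases. The global sensitivity of a real-valued function $q$ on databases is $\Delta = \max_{(d,d')\in\mathcal{N}} |q(d)-q(d')|$ (assumed to exist as a finite real number). A randomized algorithm $M$ is $(\epsilon,\delta)$-differentially private if for every measurable set $S$ of possible outputs and all $(d,d')\in\mathcal{N}$, $\Pr(M(d)\in S) \le e^{\epsilon}\Pr(M(d')\in S)+\delta$, where the probabilities are over the randomness used in $M$. Here outputs are real numbers and $S$ ranges over measurable subsets of $\mathbb{R}$. *)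

(* Defs.v *)
From HB Require Import structures.
From mathcomp Require Import all_boot all_order all_algebra.
From mathcomp Require Import finmap multiset.
From mathcomp Require Import all_classical all_reals all_analysis measurable_realfun.

Set Implicit Arguments.
Unset Strict Implicit.
Unset Printing Implicit Defensive.

Import Order.TTheory GRing.Theory Num.Theory.
Import numFieldNormedType.Exports.

Local Open Scope classical_set_scope.
Local Open Scope ring_scope.

(* A database is a finite multiset of records: order is irrelevant, repeated
   records are allowed. *)
Definition database (V : choiceType) : Type := {mset V}%mset.

Definition adds_one_record (V : choiceType) (D D' : database V) : Prop :=
  exists v : V, D' = (v +` D)%mset.

Definition neighboring (V : choiceType) : set (database V * database V) :=
  [set p | adds_one_record p.1 p.2 \/ adds_one_record p.2 p.1].

(* The maximum is attained: [Delta] is one of the differences, not merely their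
   supremum. *)
Definition is_global_sensitivity (R : realType) (V : choiceType)
    (q : database V -> R) (Delta : R) : Prop :=
  let differences := [set `|q p.1 - q p.2| | p in @neighboring V] in
  differences Delta /\ ubound differences Delta.

(* A randomized algorithm is a family of random variables, indexed by the input
   database, on the probability space [(Omega, P)] of the algorithm's internal
   randomness. *)
Definition differentially_private (d d' : measure_display)
    (Omega : measurableType d) (T : measurableType d') (R : realType)
    (P : probability Omega R) (V : choiceType) (epsilon delta : R)
    (M : database V -> {RV P >-> T}) : Prop :=
  forall S : set T, measurable S ->
  forall D D' : database V, neighboring (D, D') ->
  (P (M D @^-1` S) <= (expR epsilon)%:E * P (M D' @^-1` S) + delta%:E)%E.

(* The law is only compared on Borel sets: both sides are total functions on
   [set R], with no meaningful value on nonmeasurable sets. *)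
Definition standard_gaussian (d : measure_display) (Omega : measurableType d)
    (R : realType) (P : probability Omega R) (Z : {RV P >-> R}) : Prop :=
  forall A : set R, measurable A -> distribution P Z A = normal_prob 0 1 A.

Section gaussian_mechanism.
Context (d : measure_display) (Omega : measurableType d) (R : realType)
  (P : probability Omega R) (V : choiceType).
Variables (q : database V -> R) (sigma : R) (Z : {RV P >-> R}).

Definition gaussian_mechanism_fun (D : database V) (omega : Omega) : R :=
  q D + sigma * Z omega.

Fact measurable_gaussian_mechanism_fun (D : database V) :
  measurable_fun [set: Omega] (gaussian_mechanism_fun D).
Proof.
by apply: measurable_funD => //; apply: measurable_funM.
Qed.

HB.instance Definition _ (D : database V) :=
  isMeasurableFun.Build _ _ _ _ (gaussian_mechanism_fun D)
    (measurable_gaussian_mechanism_fun D).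

Definition gaussian_mechanism (D : database V) : {RV P >-> R} :=
  gaussian_mechanism_fun D.

End gaussian_mechanism.

(* Main.v *)
(* Up to scaling, the outputs on two neighboring databases are Gaussians of
   variance 1 with means 0 and b, where |b| <= Delta / sigma.  The ratio of
   their densities at x is exp(b^2/2 - b x), which exceeds exp(epsilon) only on
   the half-line epsilon < b^2/2 - b x.  Off this half-line the densities are
   compared pointwise.  By symmetry its mass is Pr(Z > epsilon/|b| - |b|/2), a
   nondecreasing function of |b|, hence at most delta. *)
Require Import Defs.
From mathcomp Require Import all_boot all_order all_algebra.
From mathcomp Require Import finmap multiset.
From mathcomp Require Import all_classical all_reals all_analysis measurable_realfun.
From mathcomp Require Import ring lra.

Import Order.TTheory GRing.Theory Num.Theory.
Import numFieldNormedType.Exports.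

Local Open Scope classical_set_scope.
Local Open Scope ring_scope.

(** A measure giving each []a, b]] its length is Lebesgue measure, and the preimage of []a, b]] is
    []a - c, b - c]], of equal length. *)
Lemma lebesgue_measureDr (R : realType) (c : R) (A : set R) : measurable A ->
  pushforward lebesgue_measure (fun x : R => x + c : measurableTypeR R) A
  = lebesgue_measure A.
Proof.
have mc : measurable_fun [set: R] (fun x : R => x + c : measurableTypeR R).
  exact: measurable_funD.
move=> mA; apply/esym/lebesgue_measure_unique => //= _ [[a b]] _ <-.
rewrite /pushforward.
have -> : (fun x => x + c) @^-1` `]a, b] = `]a - c, b - c]%classic.
  by apply/seteqP; split=> x; rewrite /= !in_itv/= ltrBlDr lerBrDr.
rewrite !lebesgue_measure_itv/= !lte_fin ltrD2r.
by case: ifP => // _; rewrite -!EFinB; congr EFin; ring.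
Qed.

Lemma measurable_normal_pdfE (R : realType) (m s : R) (A : set R) :
  measurable_fun A (fun x => (normal_pdf m s x)%:E).
Proof.
by apply/measurable_funTS/measurable_EFinP; exact: measurable_normal_pdf.
Qed.

(** Change of variables [y = x + c]: Lebesgue measure is translation invariant, and the density with
    mean [m + c] at [x + c] equals the one with mean [m] at [x]. *)
Lemma normal_probDr (R : realType) (m s c : R) (A : set R) : s != 0 ->
  measurable A ->
  normal_prob m s ((fun x => x + c) @^-1` A) = normal_prob (m + c) s A.
Proof.
move=> s0 mA.
have mc : measurable_fun [set: R] (fun x : R => x + c : measurableTypeR R).
  exact: measurable_funD.
transitivity (\int[pushforward lebesgue_measure
    (fun x : R => (x + c)%R : measurableTypeR R)]_(y in A)
    (normal_pdf (m + c) s y)%:E)%E; last first.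
  by apply: eq_measure_integral => //= B mB _; exact: lebesgue_measureDr.
rewrite ge0_integral_pushforward//; last 2 first.
- exact: measurable_normal_pdfE.
- by move=> x _; rewrite lee_fin normal_pdf_ge0.
apply: eq_integral => x _ /=; congr EFin.
by rewrite !normal_pdfE// /normal_fun opprD addrACA subrr addr0.
Qed.

Lemma normal_probN (R : realType) (s : R) (A : set R) : s != 0 ->
  measurable A -> normal_prob 0 s (-%R @^-1` A) = normal_prob 0 s A.
Proof.
move=> s0 mA.
have mN : measurable_fun [set: R] (-%R : R -> measurableTypeR R) by [].
transitivity (\int[pushforward lebesgue_measure
    (-%R : R -> measurableTypeR R)]_(y in A) (normal_pdf 0 s y)%:E)%E; last first.
  by apply: eq_measure_integral => //= B mB _; exact: lebesgue_measureN.
rewrite ge0_integral_pushforward//; last 2 first.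
- exact: measurable_normal_pdfE.
- by move=> x _; rewrite lee_fin normal_pdf_ge0.
apply: eq_integral => x _ /=; congr EFin.
by rewrite !normal_pdfE// /normal_fun !subr0 sqrrN.
Qed.

(** Equal variances give equal peaks, which cancel; it remains to compare the exponents [- x^2 / 2]
    and [e - (x - b)^2 / 2]. *)
Lemma normal_pdf_le_shift (R : realType) (e b x : R) : b ^+ 2 / 2 - b * x <= e ->
  normal_pdf 0 1 x <= expR e * normal_pdf b 1 x.
Proof.
move=> ex; rewrite !normal_pdfE ?oner_neq0// mulrCA.
rewrite ler_wpM2l ?normal_peak_ge0// -expRD ler_expR.
by rewrite expr1n subr0; nra.
Qed.

Lemma measurable_privacy_loss_gt (R : realType) (e b : R) :
  measurable [set x : R | e < b ^+ 2 / 2 - b * x].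
Proof.
rewrite (_ : [set x | _] = (fun x => b ^+ 2 / 2 - b * x) @^-1` `]e, +oo[).
  rewrite -[X in measurable X]setTI.
  apply: (_ : measurable_fun _ (fun x => b ^+ 2 / 2 - b * x)) => //.
  by apply: measurable_funB => //; exact: measurable_funM.
by apply: eq_set => x /=; rewrite in_itv/= andbT.
Qed.

Lemma normal_prob_le_shift (R : realType) (e b : R) (A : set R) : measurable A ->
  (normal_prob 0 1 A <= (expR e)%:E * normal_prob b 1 A
     + normal_prob 0 1 [set x | (e < b ^+ 2 / 2 - b * x)%R])%E.
Proof.
move=> mA; set B := [set x | _].
have mB : measurable B by exact: measurable_privacy_loss_gt.
have pdf0 (m x : R) : (0 <= (normal_pdf m 1 x)%:E)%E.
  by rewrite lee_fin normal_pdf_ge0.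
have mAB : measurable (A `\` B) by exact: measurableD.
have sub (m : R) (C D : set R) : measurable C -> measurable D -> C `<=` D ->
    (normal_prob m 1 C <= normal_prob m 1 D)%E.
  by move=> mC mD; apply: (@le_measure _ _ _ (normal_prob m 1)); rewrite inE.
(* [A] is split along [B]: the part inside is bounded by the mass of all of [B], the part outside by
   integrating the pointwise comparison of densities. *)
rewrite (measureDI (normal_prob 0 1) mA mB).
apply: leeD; last by apply: sub => //; exact: measurableI.
apply: (@le_trans _ _ ((expR e)%:E * normal_prob b 1 (A `\` B)))%E; last first.
  by apply: lee_wpmul2l; [rewrite lee_fin expR_ge0|exact: sub].
rewrite -ge0_integralZl//; last exact: measurable_normal_pdfE.
apply: ge0_le_integral => //.
- exact: measurable_normal_pdfE.
- by apply: measurable_funeM; exact: measurable_normal_pdfE.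
move=> x [_ /negP]; rewrite -leNgt => xB.
by rewrite -EFinM lee_fin normal_pdf_le_shift.
Qed.

(** Dividing by [c] gives [e / c - c / 2 < x]; since [e] is nonnegative, the left side does not
    increase when [c] grows to [a]. *)
Lemma privacy_loss_tail (R : realType) (e a c x : R) : 0 <= e -> 0 < c <= a ->
  e < c ^+ 2 / 2 + c * x -> e / a - a / 2 < x.
Proof.
move=> e0 /andP[c0 ca] ex; apply: (@le_lt_trans _ _ (e / c - c / 2)).
  apply: lerB; last by rewrite ler_pM2r ?invr_gt0.
  by rewrite ler_wpM2l// lef_pV2// posrE (lt_le_trans c0).
by rewrite ltrBlDr ltr_pdivrMr//; nra.
Qed.

Lemma normal_prob_privacy_loss (R : realType) (e a b : R) :
  0 <= e -> `|b| <= a ->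
  (normal_prob 0 1 [set x : R | (e < b ^+ 2 / 2 - b * x)%R]
   <= normal_prob 0 1 [set x : R | (e / a - a / 2 < x)%R])%E.
Proof.
move=> e0 ba.
have mtail : measurable [set x : R | e / a - a / 2 < x].
  by rewrite -set_itvoy.
have [b0|b0|->] := ltgtP b 0; last first.
(* For [b = 0] the condition reads [e < 0], so the set is empty. *)
- rewrite [X in normal_prob _ _ X](_ : _ = set0) ?measure0//.
  by apply/seteqP; split=> x //=; rewrite expr0n mul0r mul0r subr0 ltNge e0.
(* For [b > 0] the half-line is a left tail; reflection makes it a right tail, and
   [privacy_loss_tail] applies with [c = b]. *)
- rewrite gtr0_norm// in ba.
  rewrite -normal_probN ?oner_neq0//; last exact: measurable_privacy_loss_gt.
  apply: le_measure; rewrite ?inE//.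
    rewrite /preimage/=; under eq_set do rewrite mulrN -mulNr -sqrrN.
    exact: measurable_privacy_loss_gt.
  move=> x /=; rewrite mulrN opprK.
  by apply: privacy_loss_tail; rewrite // b0.
(* For [b < 0] it is already a right tail, with [c = - b]. *)
- rewrite ltr0_norm// in ba.
  apply: le_measure; rewrite ?inE//; first exact: measurable_privacy_loss_gt.
  move=> x /=; rewrite -sqrrN -mulNr.
  by apply: privacy_loss_tail; rewrite // oppr_gt0 b0.
Qed.

Theorem corollary1 (R : realType) (d : measure_display)
    (Omega : measurableType d) (P : probability Omega R) (Z : {RV P >-> R})
    (hZ : standard_gaussian Z)
    (V : choiceType) (q : database V -> R) (Delta : R)
    (hq : is_global_sensitivity q Delta) (hDelta : 0 < Delta)
    (sigma epsilon delta : R)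
    (hsigma : 0 < sigma) (hepsilon : 0 <= epsilon) (hdelta : 0 <= delta)
    (htail : (P [set omega | (sigma * epsilon / Delta - Delta / (2 * sigma)
                                < Z omega)%R] <= delta%:E)%E) :
  differentially_private epsilon delta (gaussian_mechanism q sigma Z).
Proof.
move=> S mS D D' DD'; have [_ qD] := hq.
have sigma0 : sigma != 0 by rewrite gt_eqF.
have Delta0 : Delta != 0 by rewrite gt_eqF.
(* The difference of the means in units of [sigma], so that
   [q D' + sigma * z = q D + sigma * (z + b)]. *)
pose b := (q D' - q D) / sigma.
have b_le : `|b| <= Delta / sigma.
  rewrite normrM normfV (gtr0_norm hsigma) ler_pM2r ?invr_gt0// distrC.
  by apply: qD; exists (D, D').
(* In standard units, the output on [D] lies in [S] exactly when [Z] lies in [T], and the output on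
   [D'] exactly when [Z + b] does. *)
pose T := [set z | S (q D + sigma * z)].
have mT : measurable T.
  rewrite -[T]setTI; apply: (_ : measurable_fun _ (fun z => q D + sigma * z)) => //.
  by apply: measurable_funD => //; exact: measurable_funM.
have mTb : measurable ((fun z => z + b) @^-1` T).
  have mDb : measurable_fun [set: R] (fun z => z + b) by exact: measurable_funD.
  by rewrite -[X in measurable X]setTI; exact: mDb.
have -> : P (gaussian_mechanism q sigma Z D @^-1` S) = normal_prob 0 1 T.
  exact: hZ.
have -> : P (gaussian_mechanism q sigma Z D' @^-1` S) = normal_prob b 1 T.
  rewrite -[b in RHS]add0r -normal_probDr ?oner_neq0// -hZ//.
  congr (P _); apply: eq_set => w /=; congr S.
  by rewrite /gaussian_mechanism/= /gaussian_mechanism_fun /b; field.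
apply: le_trans (normal_prob_le_shift _ epsilon b _ mT) _.
apply: leeD => //; apply: le_trans htail.
apply: le_trans (normal_prob_privacy_loss _ _ _ _ hepsilon b_le) _.
rewrite -hZ; last by rewrite -set_itvoy.
(* At [a = Delta / sigma] the threshold [epsilon / a - a / 2] is the one in [htail]. *)
rewrite (_ : _ - _ = sigma * epsilon / Delta - Delta / (2 * sigma))//.
by field; rewrite Delta0 sigma0.
Qed.
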